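(* Irreducible nonequivalent $*$-representations of $\mathcal P_{3,com}$ generate all nonisomorphic transitive systems of three subspaces of a finite dimensional linear space. Precisely: the system $(H;P_1H,P_2H,P_3H)$ generated by any irreducible $*$-representation of $\mathcal P_{3,com}$ is transitive; nonequivalent irreducible $*$-representations generate nonisomorphic systems; and every transitive system $(U;K_1,K_2,K_3)$ of three subspaces of a finite dimensional complex linear space $U$ is isomorphic to the system generated by some irreducible $*$-representation of $\mathcal P_{3,com}$.
   Context: All spaces are complex and nonzero; subspaces of Hilbert spaces are closed; $B(H)$ denotes the bounded linear operators on $H$. A finite dimensional linear space is regarded as a Hilbert space with any inner product (the notions of transitivity and isomorphism below do not depend on the choice). A system of $n$ subspaces is a tuple $S=(H;H_1,\ldots,H_n)$, where $H$ is a Hilbert space and $H_1,\ldots,H_n$ are subspaces of $H$. Two systems $S=(H;H_1,\ldots,H_n)$ and $\tilde S=(\tilde H;\tilde H_1,\ldots,\tilde H_n)$ are isomorphic if there is a bounded linear bijection $R:H\to\tilde H$ with $R(H_i)=\tilde H_i$ for all $i=1,\ldots,n$. Put $\mathrm{End}(S)=\{R\in B(H): R(H_i)\subset H_i,\ i=1,\ldots,n\}$. The system $S$ is transitive if $\mathrm{End}(S)=\mathbb C I_H$. $\mathcal P_{n,com}$ is the unital $*$-algebra generated by $p_1,\ldots,p_n$ with relations $p_k^2=p_k^*=p_k$ and $[\sum_{k=1}^n p_k,p_i]=0$ for all $i=1,\ldots,n$. A $*$-representation of $\mathcal P_{n,com}$ on a Hilbert space $H$ is a tuple $(P_1,\ldots,P_n)$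 of orthogonal projections on $H$ such that $\sum_k P_k$ commutes with every $P_i$. It is irreducible if $P_1,\ldots,P_n$ have no common invariant closed subspaces other than $0$ and $H$. Representations $(P_i)$ on $H$ and $(\tilde P_i)$ on $\tilde H$ are (unitarily) equivalent if there is a unitary operator $R:H\to\tilde H$ with $RP_i=\tilde P_iR$ for all $i$. The system generated by $(P_1,\ldots,P_n)$ is $(H;P_1H,\ldots,P_nH)$. *)

(* Defs.v *)
From HB Require Import structures.
From mathcomp Require Import all_boot all_order all_algebra.
From mathcomp Require Import complex.
From mathcomp Require Import all_classical all_reals all_analysis.

Set Implicit Arguments.
Unset Strict Implicit.
Unset Printing Implicit Defensive.

Import Order.TTheory GRing.Theory Num.Theory.
Import numFieldNormedType.Exports.

Local Open Scope classical_set_scope.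
Local Open Scope ring_scope.
Local Open Scope complex_scope.

(* All spaces are nonzero by convention, so nontriviality is part of the
   structure.  [inner] is linear in its first argument; its norm is the norm of
   the complete normed space. *)
HB.mixin Record isHilbert (R : realType) H of CompleteNormedModule R[i] H := {
  inner : {dot H for (@Num.conj R[i])};
  inner_norm : forall x : H, inner x x = `|x| ^+ 2;
  hilbert_nonzero : exists x : H, x != 0
}.

#[short(type="hilbertType")]
HB.structure Definition Hilbert (R : realType) :=
  { H of isHilbert R H & CompleteNormedModule R[i] H }.

(* A finite dimensional linear space with an arbitrary inner product. *)
#[short(type="fdHilbertType")]
HB.structure Definition FdHilbert (R : realType) :=
  { H of Hilbert R H & Vector R[i] H }.

Notation "'[< x , y >]" := (@inner _ _ x y)
  (at level 2, x at level 200, y at level 200).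

Record clsubspace (R : realType) (H : hilbertType R) := ClSubspace {
  clsubspace_set :> set H;
  clsubspace_submod : submod_closed [in clsubspace_set];
  clsubspace_closed : closed clsubspace_set
}.

Record boundedOp (R : realType) (H H' : hilbertType R) := BoundedOp {
  boundedOp_linear :> {linear H -> H'};
  boundedOp_bounded : exists M : R[i], forall x, `|boundedOp_linear x| <= M * `|x|
}.

Definition system (R : realType) (n : nat) (H : hilbertType R) :=
  'I_n -> clsubspace H.

Definition isomorphic (R : realType) (n : nat) (H H' : hilbertType R)
    (S : system n H) (S' : system n H') : Prop :=
  exists A : boundedOp H H', bijective A /\ forall i, A @` S i = S' i.

Definition endomorphisms (R : realType) (n : nat) (H : hilbertType R) (S : system n H) :
    set (boundedOp H H) :=
  [set A | forall i, A @` S i `<=` S i].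

Definition transitive_system (R : realType) (n : nat) (H : hilbertType R)
    (S : system n H) : Prop :=
  endomorphisms S = [set A | exists c : R[i], forall x, A x = c *: x].

Definition orthogonal_projection (R : realType) (H : hilbertType R)
    (P : boundedOp H H) : Prop :=
  (forall x, P (P x) = P x) /\ (forall x y, '[< P x, y >] = '[< x, P y >]).

(* The *-representations on H of the unital *-algebra generated by n
   self-adjoint idempotents commuting with their sum, given by the images of the
   generators. *)
Record starRep (R : realType) (n : nat) (H : hilbertType R) := StarRep {
  starRep_proj :> 'I_n -> boundedOp H H;
  starRep_orthogonal : forall i, orthogonal_projection (starRep_proj i);
  starRep_com : forall i x,
    \sum_k starRep_proj k (starRep_proj i x) =
    starRep_proj i (\sum_k starRep_proj k x)
}.

Definition irreducible_rep (R : realType) (n : nat) (H : hilbertType R)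
    (P : starRep n H) : Prop :=
  forall M : clsubspace H, (forall i, P i @` M `<=` M) ->
  (M : set H) = [set 0] \/ (M : set H) = setT.

Definition unitary (R : realType) (H H' : hilbertType R)
    (V : boundedOp H H') : Prop :=
  bijective V /\ forall x y, '[< V x, V y >] = '[< x, y >].

Definition unitarily_equivalent (R : realType) (n : nat) (H H' : hilbertType R)
    (P : starRep n H) (P' : starRep n H') : Prop :=
  exists2 V : boundedOp H H', unitary V & forall i x, V (P i x) = P' i (V x).

Lemma boundedOp_continuous (R : realType) (H H' : hilbertType R)
  (A : boundedOp H H') : continuous A.
Proof.
apply: bounded_linear_continuous; apply/linear_boundedP.
have [M AM] := boundedOp_bounded A.
have [x x0] := @hilbert_nonzero R H.
have x_gt0 : 0 < `|x| by rewrite normr_gt0.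
have M0 : 0 <= M.
  by rewrite -(pmulr_lge0 _ x_gt0); apply: le_trans (AM x).
near=> r => y; apply: le_trans (AM y) _; apply: ler_wpM2r => //.
by near: r; apply: nbhs_pinfty_ge; rewrite realE M0.
Unshelve. all: by end_near. Qed.

Lemma range_submod_closed (R : realType) (H : hilbertType R)
  (A : boundedOp H H) : submod_closed [in range A].
Proof.
split=> [|c u v]; first by rewrite inE; exists 0 => //; rewrite linear0.
by rewrite !inE => -[x _ <-] [y _ <-]; exists (c *: x + y) => //; rewrite linearP.
Qed.

Lemma range_projection_closed (R : realType) (H : hilbertType R)
  (P : boundedOp H H) : orthogonal_projection P -> closed (range P).
Proof.
move=> [PP _].
have -> : range P = (fun x => P x - x) @^-1` [set 0].
  apply/seteqP; split=> x /=; first by move=> [y _ <-]; rewrite PP subrr.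
  by move/eqP; rewrite subr_eq0 => /eqP <-; exists x.
apply: preimage_closed; last first.
  exact: accessible_closed_set1 (hausdorff_accessible (@norm_hausdorff _ _)) _.
by move=> x _; apply: cvgB; [exact: boundedOp_continuous|exact: cvg_id].
Qed.

Definition generated (R : realType) (n : nat) (H : hilbertType R)
    (P : starRep n H) : system n H :=
  fun i => ClSubspace (range_submod_closed (P i))
                      (range_projection_closed (starRep_orthogonal P i)).

(* Main.v *)
(** Let [s] be the sum of the projections of an irreducible representation.
    Multiplying [P k ^+ 2 = P k], with [P k = s - P i - P j], by [P i] and
    comparing the result with its adjoint gives
    [(2 s - 3) (P i P j - P j P i) = 0].  The kernel of [2 s - 3] is invariant,
    so either the projections commute, each is [0] or [1] and the space is a
    line, or [2 s = 3].  In the second case [P i P j P i = P i / 4], so that the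
    space is spanned by [x] and [P j x] for any nonzero [x] in the range of
    [P i]; moreover any operator sending the ranges of one such triple into
    those of another intertwines the two representations.  This gives
    transitivity, and shows that an isomorphism of systems is a multiple of a
    unitary equivalence.

    Conversely, testing transitivity on rank one operators shows that, outside
    dimension one, the three subspaces are pairwise supplementary; one more
    family of endomorphisms shows that the space is a plane with three distinct
    lines, which a linear map moves to lines at angles of 120 degrees. *)
From HB Require Import structures.
Require Import Defs.
From mathcomp Require Import all_boot all_order all_algebra.
From mathcomp Require Import complex ring.
From mathcomp Require Import all_classical all_reals all_analysis.

Set Implicit Arguments.
Unset Strict Implicit.
Unset Printing Implicit Defensive.

Import Order.TTheory GRing.Theory Num.Theory.
Import numFieldNormedType.Exports.

Local Open Scope classical_set_scope.
Local Open Scope ring_scope.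
Local Open Scope complex_scope.

(** * Bounded operators on Hilbert spaces *)

Section Inner.
Variables (R : realType) (H : hilbertType R).
Implicit Types (x y z : H) (a : R[i]).

Lemma innerDl x y z : '[< x + y, z >] = '[< x, z >] + '[< y, z >].
Proof. exact: linearDl. Qed.
Lemma innerDr x y z : '[< x, y + z >] = '[< x, y >] + '[< x, z >].
Proof. exact: linearDr. Qed.
Lemma innerZl a x z : '[< a *: x, z >] = a * '[< x, z >].
Proof. exact: linearZl_LR. Qed.
Lemma innerZr a x z : '[< x, a *: z >] = Num.conj a * '[< x, z >].
Proof. exact: linearZr_LR. Qed.
Lemma innerNl x z : '[< - x, z >] = - '[< x, z >].
Proof. exact: linearNl. Qed.
Lemma innerNr x z : '[< x, - z >] = - '[< x, z >].
Proof. exact: linearNr. Qed.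
Lemma inner0l z : '[< 0, z >] = 0.
Proof. exact: linear0l. Qed.
Lemma inner0r z : '[< z, 0 >] = 0.
Proof. exact: linear0r. Qed.
Lemma inner_suml (I : Type) (r : seq I) (f : I -> H) z :
  '[< \sum_(i <- r) f i, z >] = \sum_(i <- r) '[< f i, z >].
Proof. exact: linear_sumlz. Qed.
Lemma inner_sumr (I : Type) (r : seq I) (f : I -> H) z :
  '[< z, \sum_(i <- r) f i >] = \sum_(i <- r) '[< z, f i >].
Proof. exact: linear_sumr. Qed.
Lemma innerC x y : '[< x, y >] = Num.conj '[< y, x >].
Proof. by rewrite (@hermC _ _ (@Num.conj R[i])) expr0 mul1r. Qed.

Lemma inner_eq0 x : ('[< x, x >] == 0) = (x == 0).
Proof. by rewrite inner_norm sqrf_eq0 normr_eq0. Qed.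

Lemma inner_ge0 x : 0 <= '[< x, x >].
Proof. by rewrite inner_norm exprn_ge0. Qed.

(** Turns identities between vectors into scalar identities, where [ring] and [field] apply; used
    below for this purpose throughout. *)
Lemma inner_inj x y : (forall z, '[< x, z >] = '[< y, z >]) -> x = y.
Proof.
move=> xy; apply/eqP; rewrite -subr_eq0 -inner_eq0 innerDl innerNl xy.
by rewrite subrr.
Qed.

End Inner.

Definition innerE :=
  (innerDl, innerDr, innerNl, innerNr, innerZl, innerZr, inner0l, inner0r).

Section BoundedOperators.
Variables (R : realType) (H H' : hilbertType R).

(** Cauchy-Schwarz: expand the square norm of ['[< e, e >] *: x - '[< x, e >] *: e] and cancel the
    factor ['[< e, e >]]. *)
Lemma inner_norm_le (x e : H) : `|'[< x, e >]| <= `|x| * `|e|.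
Proof.
have [->|e0] := eqVneq e 0; first by rewrite inner0r normr0 mulr_ge0.
have ee : 0 < '[< e, e >] by rewrite lt_def inner_eq0 e0 inner_ge0.
rewrite -ler_sqr ?nnegrE ?mulr_ge0 // exprMn -!inner_norm normCK -innerC.
have := inner_ge0 ('[< e, e >] *: x - '[< x, e >] *: e).
have -> : '[< '[< e, e >] *: x - '[< x, e >] *: e,
              '[< e, e >] *: x - '[< x, e >] *: e >] =
    '[< e, e >] * ('[< x, x >] * '[< e, e >] - '[< x, e >] * '[< e, x >]).
  by rewrite !innerE -!innerC; ring.
by rewrite pmulr_rge0 // subr_ge0.
Qed.

Definition bounded_map (f : H -> H') : Prop :=
  exists M : R[i], forall x, `|f x| <= M * `|x|.

Lemma bounded_mapD (f g : H -> H') :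
  bounded_map f -> bounded_map g -> bounded_map (fun x => f x + g x).
Proof.
move=> [M fM] [N gN]; exists (M + N) => x; rewrite mulrDl.
by apply: le_trans (ler_normD _ _) _; apply: lerD.
Qed.

Lemma bounded_mapZ (a : R[i]) (f : H -> H') :
  bounded_map f -> bounded_map (fun x => a *: f x).
Proof.
by move=> [M fM]; exists (`|a| * M) => x; rewrite normrZ -mulrA ler_wpM2l.
Qed.

Lemma bounded_map_sum (I : Type) (r : seq I) (f : I -> H -> H') :
  (forall i, bounded_map (f i)) -> bounded_map (fun x => \sum_(i <- r) f i x).
Proof.
move=> fb; elim: r => [|i r [M IH]].
  by exists 0 => x; rewrite big_nil normr0 mul0r.
have [N fN] := bounded_mapD (fb i) (ex_intro _ M IH).
by exists N => x; rewrite big_cons.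
Qed.

Lemma boundedOpP (f : H -> H') : linear f -> bounded_map f ->
  exists A : boundedOp H H', A =1 f.
Proof.
move=> lin_f bf.
pose mf := GRing.isLinear.Build R[i] H H' _ f lin_f.
pose F : {linear H -> H'} := HB.pack f mf.
have bF : exists M : R[i], forall x, `|F x| <= M * `|x| by exact: bf.
by exists (BoundedOp bF).
Qed.

Definition rank1 (f : H) (e : H') (x : H) : H' := '[< x, f >] *: e.

Lemma rank1_linear (f : H) (e : H') : linear (rank1 f e).
Proof. by move=> a x y; rewrite /rank1 !innerE scalerDl scalerA. Qed.

HB.instance Definition _ f e :=
  GRing.isLinear.Build R[i] H H' _ (rank1 f e) (@rank1_linear f e).

Lemma rank1_bounded (f : H) (e : H') :
  bounded_map (rank1 f e).
Proof.
exists (`|f| * `|e|) => x; rewrite normrZ mulrAC ler_wpM2r //.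
by rewrite mulrC inner_norm_le.
Qed.

Lemma op_kernel_submod_closed (f : {linear H -> H'}) :
  submod_closed [in [set x | f x = 0]].
Proof.
split=> [|a x y]; first by rewrite inE /= linear0.
by rewrite !inE /= => fx fy; rewrite linearP fx fy scaler0 addr0.
Qed.

Lemma op_kernel_closed (A : boundedOp H H') : closed [set x | A x = 0].
Proof.
rewrite (_ : [set x | A x = 0] = A @^-1` [set 0]) //.
apply: preimage_closed; first by move=> x _; exact: boundedOp_continuous.
exact: accessible_closed_set1 (hausdorff_accessible (@norm_hausdorff _ _)) _.
Qed.

Definition op_kernel (A : boundedOp H H') : clsubspace H :=
  ClSubspace (op_kernel_submod_closed A) (@op_kernel_closed A).

End BoundedOperators.

Section Line.
Variables (R : realType) (H : hilbertType R).

Lemma line_submod_closed (e : H) :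
  submod_closed [in [set x | exists a : R[i], x = a *: e]].
Proof.
split=> [|a x y]; first by rewrite inE; exists 0; rewrite scale0r.
rewrite !inE => -[b ->] [c ->]; exists (a * b + c).
by rewrite scalerA scalerDl.
Qed.

Lemma line_proj_unit (e : H) : '[< e, e >] = 1 ->
  orthogonal_projection (BoundedOp (rank1_bounded e e)).
Proof.
move=> ee; split=> [x|x y] /=; rewrite /rank1 !innerE; first by rewrite ee mulr1.
by rewrite -innerC mulrC.
Qed.

(** A nonzero line is the range of the rank one projection on its normalized generator, and ranges
    of orthogonal projections are closed. *)
Lemma line_closed (e : H) : closed [set x | exists a : R[i], x = a *: e].
Proof.
have [->|e0] := eqVneq e 0.
  rewrite (_ : mkset _ = [set 0]); first exact: accessible_closed_set1
     (hausdorff_accessible (@norm_hausdorff _ _)) _.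
  apply/seteqP; split=> x /=; first by move=> [a ->]; rewrite scaler0.
  by move=> ->; exists 0; rewrite scale0r.
have ne : `|e| != 0 by rewrite normr_eq0.
pose f := `|e|^-1 *: e.
have ff : '[< f, f >] = 1.
  rewrite /f !innerE inner_norm geC0_conj ?invr_ge0 //; field.
  done.
rewrite (_ : mkset _ = range (BoundedOp (rank1_bounded f f))).
  exact: range_projection_closed (line_proj_unit ff).
apply/seteqP; split=> x /=; rewrite /rank1.
  move=> [a ->]; exists (a *: e) => //; rewrite /f !innerE scalerA.
  rewrite inner_norm geC0_conj ?invr_ge0 //; congr (_ *: _).
  by field.
move=> [y _ <-]; rewrite scalerA; eexists; reflexivity.
Qed.

Definition line (e : H) : clsubspace H :=
  ClSubspace (line_submod_closed e) (@line_closed e).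

End Line.

(** * Three projections commuting with their sum *)

(** Lets [ring] and [field] use a known equation [c = d]: it remains to compare the two differences
    formally. *)
Lemma eq_of_subr (V : zmodType) (a b c d : V) : c = d -> a - b = c - d -> a = b.
Proof. by move=> -> /eqP; rewrite subrr subr_eq0 => /eqP. Qed.

(** Allows the three projections to be treated symmetrically, under any labelling [i], [j], [k]. *)
Lemma third_index (i j : 'I_3) : i != j -> exists k : 'I_3,
  [/\ k != i, k != j, forall l, [\/ l = i, l = j | l = k] &
      forall (V : zmodType) (F : 'I_3 -> V), \sum_l F l = F i + F j + F k].
Proof.
move=> ij; pose A := ~: [set i; j].
have A1 : #|A| = 1%N by rewrite cardsCs finset.setCK cards2 ij card_ord.
have /cards1P[k Ak] : #|A| == 1%N by rewrite A1.
have lA l : (l != i) && (l != j) = (l == k).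
  by rewrite -[RHS]finset.in_set1 -Ak !inE negb_or.
have /andP[ki kj] : (k != i) && (k != j) by rewrite lA.
exists k; split=> // [l|V F].
  have [->|li] := eqVneq l i; first by constructor 1.
  have [->|lj] := eqVneq l j; first by constructor 2.
  by constructor 3; apply/eqP; rewrite -lA li lj.
rewrite (bigD1 i) //= (bigD1 j) 1?eq_sym //= addrA; congr (_ + _).
by rewrite (eq_bigl _ _ lA) big_pred1_eq.
Qed.

Section ThreeProjections.
Variables (R : realType) (H : hilbertType R) (P : starRep 3 H).
Implicit Types (i j k : 'I_3) (x y : H).

Definition rep_sum x := \sum_k P k x.

Lemma rep_idem i x : P i (P i x) = P i x.
Proof. by have [-> _] := starRep_orthogonal P i. Qed.

Lemma rep_adj i x y : '[< P i x, y >] = '[< x, P i y >].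
Proof. by have [_ ->] := starRep_orthogonal P i. Qed.

Lemma rep_sum_linear : linear rep_sum.
Proof.
move=> a x y; rewrite /rep_sum scaler_sumr -big_split.
by apply: eq_bigr => k _; rewrite linearP.
Qed.

HB.instance Definition _ :=
  GRing.isLinear.Build R[i] H H _ rep_sum rep_sum_linear.

Lemma rep_sumC i x : P i (rep_sum x) = rep_sum (P i x).
Proof. by rewrite /rep_sum starRep_com. Qed.

Lemma rep_sum_adj x y : '[< rep_sum x, y >] = '[< x, rep_sum y >].
Proof.
have [k [_ _ _ E]] := @third_index 0 1 isT.
by rewrite /rep_sum !E !innerE !rep_adj.
Qed.

Lemma rep_range i x : range (P i) x <-> P i x = x.
Proof. by split=> [[y _ <-]|<-]; [exact: rep_idem|exists x]. Qed.

(* This is the relation [P k ^+ 2 = P k] for the third projection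
   [P k = s - P i - P j], multiplied by [P i] on the left. *)
Lemma rep_triple i j x : i != j ->
  P i (P j (P i x)) = 2 *: rep_sum (P i (P j x)) - 3 *: P i (P j x)
    - (rep_sum (rep_sum (P i x)) - 3 *: rep_sum (P i x) + 2 *: P i x).
Proof.
move=> ij; have [k [_ _ _ E]] := third_index ij.
have Pk y : P k y = rep_sum y - P i y - P j y.
  by rewrite /rep_sum E -addrA -opprD [_ + P k y]addrC addrK.
have := congr1 (P i) (rep_idem k x); rewrite !Pk.
rewrite !(linearD, linearN) /= !rep_sumC !rep_idem => e.
apply: inner_inj => w; have := congr1 (fun z => '[< z, w >]) e.
rewrite !innerE => {}e; apply: eq_of_subr e _.
ring.
Qed.

(* Compare [rep_triple] with its adjoint. *)
Lemma rep_sum_commutator i j x : i != j ->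
  2 *: rep_sum (P i (P j x) - P j (P i x)) = 3 *: (P i (P j x) - P j (P i x)).
Proof.
move=> ij; apply: inner_inj => w.
have e1 := congr1 (fun z => '[< z, w >]) (rep_triple x ij).
have e2 := congr1 (fun z => '[< x, z >]) (rep_triple w ij).
rewrite /= in e1 e2.
move: e2; rewrite -!rep_adj e1 !(linearD, linearN) /= !innerE !rmorph_nat.
rewrite -!rep_sum_adj -!rep_adj !rep_sumC.
by move=> e; apply: eq_of_subr e _; ring.
Qed.

End ThreeProjections.

Lemma linear_comb (R : pzRingType) (U V : lmodType R) (f : {linear U -> V})
  (a b : R) x y : f (a *: x + b *: y) = a *: f x + b *: f y.
Proof. by rewrite linearD !linearZZ. Qed.

Section Cases.
Variables (R : realType) (H : hilbertType R) (P : starRep 3 H).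
Implicit Types (i j k : 'I_3) (x y : H).

(** The sum of the projections is 3/2. For rank one projections, unit vectors in the ranges then
    form a tight frame, whence the name. *)
Definition tight := forall x, 2 *: rep_sum P x = 3 *: x.

Definition trivial_proj i :=
  (forall x, P i x = 0) \/ (forall x, P i x = x).

Lemma irreducible_trivial_or_tight : irreducible_rep P ->
  (forall i, trivial_proj i) \/ tight.
Proof.
move=> irrP.
have [B BE] : exists B : boundedOp H H,
    B =1 fun x => 2 *: rep_sum P x + (- 3) *: x.
  apply: boundedOpP.
    move=> a x y; rewrite linearP /=.
    by apply: inner_inj => w; rewrite !innerE; ring.
  apply: bounded_mapD; last first.
    by apply: bounded_mapZ; exists 1 => x; rewrite mul1r.
  apply: bounded_mapZ; apply: bounded_map_sum => i.
  exact: boundedOp_bounded.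
have BP i x : B (P i x) = P i (B x).
  by rewrite !BE linear_comb rep_sumC.
have B0 x : B x = 0 <-> 2 *: rep_sum P x = 3 *: x.
  rewrite BE scaleNr; split=> [/eqP|->]; last by rewrite subrr.
  by rewrite subr_eq0 => /eqP.
have [|K0|KT] := irrP (op_kernel B).
- by move=> i _ [x /= Bx <-]; rewrite BP Bx linear0.
(* When the kernel is zero, the commutators vanish, since they lie in it by [rep_sum_commutator].
   Each range is then invariant, hence zero or everything. *)
- left=> i.
  have PC j x : P i (P j x) = P j (P i x).
    have [->//|ij] := eqVneq i j.
    have : [set x | B x = 0] (P i (P j x) - P j (P i x)).
      by apply/B0/rep_sum_commutator.
    by rewrite [X in X _]K0 /= => /eqP; rewrite subr_eq0 => /eqP.
  have [|M0|MT] := irrP (generated P i).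
  + by move=> j _ [_ [y _ <-] <-]; exists (P j y).
  + left=> x; have : range (P i) (P i x) by exists x.
    by rewrite [X in X _]M0.
  + by right=> x; apply/rep_range; rewrite [X in X _]MT.
- by right=> x; apply/B0; have : setT x by []; rewrite -[X in X _]KT.
Qed.

(** Projections equal to 0 or 1 leave every line invariant. *)
Lemma trivial_irreducible_line : irreducible_rep P ->
  (forall i, trivial_proj i) -> forall x, x != 0 ->
  forall y, exists a, y = a *: x.
Proof.
move=> irrP trP x x0 y.
have [|L0|LT] := irrP (line x).
- move=> i _ [z /= [a ->] <-]; case: (trP i) => -> ; last by exists a.
  by exists 0; rewrite scale0r.
- have : (line x : set H) x by exists 1; rewrite scale1r.
  by rewrite [X in X _]L0 => /eqP; rewrite (negPf x0).
- by have : setT y by []; rewrite -[X in X _]LT.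
Qed.

Hypothesis tightP : tight.

Lemma tight_third i j k x : (forall (V : zmodType) (F : 'I_3 -> V),
    \sum_l F l = F i + F j + F k) ->
  P k x = (3 / 2) *: x - P i x - P j x.
Proof.
move=> E; have := tightP x; rewrite /rep_sum E => e.
apply: inner_inj => w; have := congr1 (fun z => '[< z, w >]) e.
rewrite /= !innerE => {}e.
by apply/(mulfI (_ : 2 != 0 :> R[i])) => //; apply: eq_of_subr e _; field.
Qed.

(** In [rep_triple] with [s = 3/2] the terms in [P i (P j x)] cancel, and [s^2 - 3 s + 2] takes the
    value -1/4. *)
Lemma tight_triple i j x : i != j -> 4 *: P i (P j (P i x)) = P i x.
Proof.
move=> ij; rewrite rep_triple //.
have e1 := tightP (P i (P j x)).
have e2 := tightP (P i x).
have e3 := tightP (rep_sum P (P i x)).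
apply: inner_inj => w.
have := congr1 (fun z => '[< z, w >]) e1.
have := congr1 (fun z => '[< z, w >]) e2.
have := congr1 (fun z => '[< z, w >]) e3.
rewrite /= !innerE.
set t3 := '[< rep_sum P (rep_sum P _), w >]; set t2 := '[< rep_sum P (P i x), w >].
set t1 := '[< rep_sum P _, w >].
have solve (a b : R[i]) : 2 * a = 3 * b -> a = 3 / 2 * b.
  by move=> ab; apply/(mulfI (_ : 2 != 0 :> R[i])) => //; rewrite ab; field.
by move=> /solve -> /solve -> /solve ->; field.
Qed.

Lemma tight_tripleV i j x : i != j -> P i (P j (P i x)) = 4^-1 *: P i x.
Proof.
move=> ij; rewrite -[in RHS](tight_triple x ij).
by rewrite scalerA mulVf ?scale1r ?pnatr_eq0.
Qed.

(** If [P i] were zero, [tight_triple] would make every [P j] zero, against the sum being 3/2. *)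
Lemma tight_nonzero i : exists2 x, x != 0 & P i x = x.
Proof.
have [|P0] := pselect (exists x, P i x != 0).
  by move=> [x Px]; exists (P i x) => //; exact: rep_idem.
have {}P0 x : P i x = 0 by apply: contrapT => /eqP Px; apply: P0; exists x.
have [x x0] := @hilbert_nonzero R H.
have Pz j y : P j y = 0.
  have [<-//|ij] := eqVneq i j.
  by rewrite -(@tight_triple j i) 1?eq_sym // P0 linear0 scaler0.
have := tightP x; rewrite /rep_sum big1 // scaler0 => /esym/eqP.
by rewrite scaler_eq0 pnatr_eq0 (negPf x0).
Qed.

(** The vectors [v] for which [P i v] and [P i (P j v)] both lie on the line of [x] form a closed
    subspace [M]. It is invariant under [P i] because [P i P j P i = P i / 4], under [P j] because
    [P j] is idempotent, and under [P k = 3/2 - P i - P j]. It contains [x], so it is the whole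
    space. *)
Lemma tight_range i x : irreducible_rep P -> x != 0 -> P i x = x ->
  forall y, exists a, P i y = a *: x.
Proof.
move=> irrP x0 Pix.
have [j ij] : exists j, i != j.
  by have [->|] := eqVneq i 0; [exists 1|exists 0].
have [k [ki kj ijk E]] := third_index ij.
pose M := [set v | exists a, P i v = a *: x] `&`
    [set v | exists a, P i (P j v) = a *: x].
have M_sub : submod_closed [in M].
  split; first by rewrite inE; split; exists 0; rewrite ?linear0 scale0r.
  move=> a u v; rewrite !inE => -[[b1 e1] [b2 e2]] [[c1 f1] [c2 f2]].
  split; [exists (a * b1 + c1) | exists (a * b2 + c2)];
  by rewrite !linearP /= ?e1 ?e2 ?f1 ?f2 scalerDl scalerA.
have M_cl : closed M.
  apply: closedI; apply: (@preimage_closed _ _ _ (line x)) (@line_closed _ _ x).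
    by move=> ? _; exact: boundedOp_continuous.
  move=> v _; apply: (@continuous_comp _ _ _ (P j) (P i));
  exact: boundedOp_continuous.
have ML a u v : M u -> M v -> M (a *: u + v).
  by have := M_sub.2 a u v; rewrite !inE.
have Mi v : M v -> M (P i v).
  move=> [[a e] _]; split; first by exists a; rewrite rep_idem.
  by exists (4^-1 * a); rewrite -scalerA -e tight_tripleV.
have Mj v : M v -> M (P j v).
  by move=> [_ [a e]]; split; exists a; rewrite ?rep_idem.
have Mk v : M v -> M (P k v).
  move=> Mv; have M0 : M 0 by have := M_sub.1; rewrite inE.
  have -> : P k v = -1 *: P j v + (-1 *: P i v + ((3 / 2) *: v + 0)).
    by rewrite (tight_third _ E) !scaleN1r addr0 [RHS]addrC [- P i v + _]addrC.
  by apply: (ML); [exact: Mj|apply: (ML); [exact: Mi|exact: ML]].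
have [|M0|MT] := irrP (ClSubspace M_sub M_cl).
- by move=> l _ [v Mv <-]; case: (ijk l) => ->; [exact: Mi|exact: Mj|exact: Mk].
- have : M x.
    split; first by exists 1; rewrite scale1r.
    by exists 4^-1; rewrite -[in LHS]Pix tight_tripleV // Pix.
  by rewrite [X in X _]M0 => /eqP; rewrite (negPf x0).
- by move=> y; have : setT y by []; rewrite -[X in X _]MT => -[].
Qed.

(** In [3 y = 2 (P i y + P j y + P k y)] the first term is on the line of [x]. Since
    [P j y = 4 P j P i P j y], the second is on the line of [P j x], and likewise the third is on
    that of [P k x = x / 2 - P j x]. *)
Lemma tight_span i j x : i != j -> irreducible_rep P -> x != 0 -> P i x = x ->
  forall y, exists a b, y = a *: x + b *: P j x.
Proof.
move=> ij irrP x0 Pix y; have [k [ki kj ijk E]] := third_index ij.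
have ran := tight_range irrP x0 Pix.
have [a ea] := ran y; have [b eb] := ran (P j y); have [c ec] := ran (P k y).
have e2 : P j y = (4 * b) *: P j x.
  by rewrite -(@tight_triple j i) 1?eq_sym // eb linearZZ scalerA.
have e3 : P k y = (4 * c) *: P k x.
  by rewrite -(@tight_triple k i) // ec linearZZ scalerA.
have := tightP y; rewrite /rep_sum E ea e2 e3 (tight_third x E) Pix => e.
exists (2 / 3 * (a + 2 * c)), (2 / 3 * (4 * b - 4 * c)).
apply: inner_inj => w; have := congr1 (fun z => '[< z, w >]) e.
rewrite /= !innerE => {}e.
apply/(mulfI (_ : 3 != 0 :> R[i])); first by rewrite pnatr_eq0.
by apply: eq_of_subr (esym e) _; field.
Qed.

End Cases.

(** * Intertwining operators *)

Section Intertwining.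
Variables (R : realType) (H H' : hilbertType R).
Variables (P : starRep 3 H) (P' : starRep 3 H').

Section Tight.
Variable A : {linear H -> H'}.
Hypotheses (tightP : tight P) (tightP' : tight P').
Hypothesis A_range : forall i x, P i x = x -> P' i (A x) = A x.

(* With [u = P i u], the vector [A (P k u) = A u / 2 - A (P j u)] is fixed by
   [P' k = 3 / 2 - P' i - P' j]; apply [P' j] to this relation. *)
Lemma tight_intertwine_range i j u : i != j -> P i u = u ->
  A (P j u) = P' j (A u).
Proof.
move=> ij Piu; have [k [ki kj _ E]] := third_index ij.
have Ai : P' i (A u) = A u by exact: A_range.
have Aj : P' j (A (P j u)) = A (P j u) by apply: A_range; rewrite rep_idem.
have ji : P' j (P' i (A (P j u))) = 4^-1 *: A (P j u).
  by rewrite -Aj tight_tripleV // 1?eq_sym.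
have Pku : P k u = 2^-1 *: u + (- 1) *: P j u.
  rewrite (tight_third tightP u E) Piu.
  by apply: inner_inj => w; rewrite !innerE; field.
have := A_range (rep_idem P k u).
rewrite (tight_third tightP' _ E) Pku !linear_comb Ai Aj.
set a := A u; set b := A (P j u) => e.
have : P' j (-4^-1 *: a + 2^-1 *: b) + P' j (1 *: P' i b + - 2^-1 *: P' j a) = 0.
  rewrite -linearD -[RHS](linear0 (P' j)); congr (P' j _).
  apply: inner_inj => w; have := congr1 (fun z => '[< z, w >]) e.
  by rewrite /= !innerE => {}e; apply: eq_of_subr e _; field.
(* As [P' j b = b] and [P' j (P' i b) = b / 4], the relation becomes [3/4 (b - P' j a) = 0]. *)
rewrite !linear_comb Aj ji rep_idem => {}e.
apply: inner_inj => w; have := congr1 (fun z => '[< z, w >]) e.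
rewrite /= !innerE => {}e.
apply/(mulfI (_ : 3 / 4 != 0 :> R[i])).
  by rewrite mulf_neq0 ?invr_eq0 ?pnatr_eq0.
by apply: eq_of_subr e _; field.
Qed.

(** Tightness makes [x] a combination of the [P j x], so the relation need only be checked on the
    ranges. *)
Lemma tight_intertwine i x : A (P i x) = P' i (A x).
Proof.
have Aij j y : A (P i (P j y)) = P' i (A (P j y)).
  have [<-|ij] := eqVneq i j; first by rewrite rep_idem A_range ?rep_idem.
  by rewrite (@tight_intertwine_range j i) 1?eq_sym ?rep_idem.
apply: (scalerI (_ : 3 != 0 :> R[i])); first by rewrite pnatr_eq0.
rewrite -!linearZZ -tightP !linearZZ /rep_sum !linear_sum.
by apply: eq_bigr => j _; rewrite Aij.
Qed.

End Tight.

Lemma trivial_intertwine (A : {linear H -> H'}) :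
  (forall i, trivial_proj P i) -> (forall i, A @` range (P i) = range (P' i)) ->
  forall i x, A (P i x) = P' i (A x).
Proof.
move=> trP AP i x; case: (trP i) => Pi; rewrite Pi.
  have : range (P' i) (P' i (A x)) by exists (A x).
  by rewrite -AP => -[_ [z _ <-] <-]; rewrite Pi.
have : (A @` range (P i)) (A x) by exists x => //; exists x; rewrite ?Pi.
by rewrite AP => /rep_range ->.
Qed.

(** Dividing [A] by the square root of [c] makes it unitary and preserves the intertwining
    relations. *)
Lemma conformal_unitarily_equivalent (A : boundedOp H H') (c : R[i]) :
  bijective A -> (forall i x, A (P i x) = P' i (A x)) -> 0 < c ->
  (forall x y, '[< A x, A y >] = c * '[< x, y >]) -> unitarily_equivalent P P'.
Proof.
move=> bijA AP c0 Ac; pose d := (sqrtC c)^-1.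
have d0 : d != 0 by rewrite invr_eq0 sqrtC_eq0 gt_eqF.
have [V VE] : exists V : boundedOp H H', V =1 fun x => d *: A x.
  apply: boundedOpP; last by apply: bounded_mapZ; exact: boundedOp_bounded.
  by move=> a x y; rewrite linearP scalerDr !scalerA mulrC.
exists V; last by move=> i x; rewrite !VE AP linearZZ.
split.
  have [B AK BK] := bijA.
  exists (fun y => B (d^-1 *: y)) => x; rewrite VE ?scalerA.
    by rewrite mulVf ?scale1r.
  by rewrite BK scalerA mulfV ?scale1r.
have dd : d * d * c = 1 by rewrite -expr2 exprVn sqrtCK mulVf // gt_eqF.
have conj_d : Num.conj d = d by rewrite geC0_conj // invr_ge0 sqrtC_ge0 ltW.
by move=> x y; rewrite !VE !innerE Ac conj_d !mulrA dd mul1r.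
Qed.

Lemma trivial_conformal (A : {linear H -> H'}) (x : H) : x != 0 -> injective A ->
  (forall y, exists a : R[i], y = a *: x) ->
  exists2 c : R[i], 0 < c & forall y z, '[< A y, A z >] = c * '[< y, z >].
Proof.
move=> x0 injA span_x; exists ('[< A x, A x >] / '[< x, x >]).
  by rewrite divr_gt0 // lt_def inner_ge0 inner_eq0 ?x0 // raddf_eq0 // x0.
move=> y z; have [a ->] := span_x y; have [b ->] := span_x z.
by rewrite !linearZZ !innerE; field; rewrite inner_eq0.
Qed.

(** For [x] in the range of [P 0], the spanning vectors [x] and [P 1 x] have a Gram matrix equal to
    ['[< x, x >]] times a universal matrix. The same holds for their images, so [A] rescales the
    inner product. *)
Lemma tight_conformal (A : {linear H -> H'}) : injective A ->
  tight P -> tight P' -> irreducible_rep P ->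
  (forall i x, A (P i x) = P' i (A x)) ->
  exists2 c : R[i], 0 < c & forall y z, '[< A y, A z >] = c * '[< y, z >].
Proof.
move=> injA tP tP' irrP AP.
have ij : (0 : 'I_3) != 1 by [].
have [x x0 Px] := tight_nonzero tP 0.
have gram (K : hilbertType R) (Q : starRep 3 K) (u : K) : tight Q -> Q 0 u = u ->
    '[< u, Q 1 u >] = 4^-1 * '[< u, u >].
  move=> tQ Qu; rewrite -[in LHS]Qu -{1}[u]Qu rep_adj tight_tripleV // Qu innerZr.
  by rewrite fmorphV rmorph_nat.
have Px' : P' 0 (A x) = A x by rewrite -AP Px.
have := tight_span tP ij irrP x0 Px => span_x.
exists ('[< A x, A x >] / '[< x, x >]).
  by rewrite divr_gt0 // lt_def inner_ge0 inner_eq0 ?x0 // raddf_eq0 // x0.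
move=> y z; have [a [b ->]] := span_x y; have [c [d ->]] := span_x z.
rewrite !linear_comb !AP !innerE !rep_adj !rep_idem (gram _ _ _ tP Px).
by rewrite (gram _ _ _ tP' Px'); field; rewrite inner_eq0.
Qed.

(** An isomorphism would make [P 0] equal to 0 or 1. The first contradicts [tight_nonzero]; the
    second gives [4 P 1 = 1], although [P 1] fixes a nonzero vector. *)
Lemma trivial_tight_not_isomorphic : tight P -> (forall i, trivial_proj P' i) ->
  ~ isomorphic (generated P) (generated P').
Proof.
move=> tP trP' [A [/bij_inj injA AS]].
have AP i : A @` range (P i) = range (P' i) by exact: AS.
have [x x0 Px] := tight_nonzero tP 1.
case: (trP' 0) => P'0.
  have [y y0 Py] := tight_nonzero tP 0.
  have : (A @` range (P 0)) (A y) by exists y => //; exact/rep_range.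
  rewrite AP => -[z _]; rewrite P'0 => /esym/eqP.
  by rewrite raddf_eq0 // (negPf y0).
have P0 y : P 0 y = y.
  have : range (P' 0) (A y) by exists (A y); rewrite ?P'0.
  by rewrite -AP => -[_ [z _ <-] /injA <-]; rewrite rep_idem.
have := tight_triple tP x (isT : (0 : 'I_3) != 1).
rewrite !P0 Px => /eqP; rewrite -subr_eq0 -[X in _ - X]scale1r -scalerBl.
rewrite scaler_eq0 (negPf x0) orbF (_ : 4 - 1 = 3) ?pnatr_eq0 //.
by ring.
Qed.

End Intertwining.

(** In the tight case an endomorphism commutes with the projections. It therefore preserves the
    range of [P 0], which is the line of [x], and acts on [x] and on [P 1 x] by the same scalar;
    these two vectors span. *)
Lemma irreducible_transitive (R : realType) (H : hilbertType R) (P : starRep 3 H) :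
  irreducible_rep P -> transitive_system (generated P).
Proof.
move=> irrP; apply/seteqP; split=> A /=; last first.
  move=> [c Ac] i _ [_ [y _ <-] <-]; exists (c *: y) => //.
  by rewrite linearZZ Ac.
move=> AP; have A_range i x : P i x = x -> P i (A x) = A x.
  by move=> Px; apply/rep_range; apply: (AP i); exists x => //; apply/rep_range.
have [trP|tP] := irreducible_trivial_or_tight irrP.
  have [x x0] := @hilbert_nonzero R H.
  have span_x := trivial_irreducible_line irrP trP x0.
  have [a Ax] := span_x (A x); exists a => y.
  by have [b ->] := span_x y; rewrite linearZZ Ax !scalerA mulrC.
have AC := tight_intertwine tP tP A_range.
have [x x0 Px] := tight_nonzero tP 0.
have [a] := tight_range tP irrP x0 Px (A x).
rewrite -AC Px => Ax; exists a => y.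
have [b [c ->]] := tight_span tP (isT : (0 : 'I_3) != 1) irrP x0 Px y.
by rewrite linear_comb AC Ax [P 1 _]linearZZ scalerDr !scalerA mulrC [c * a]mulrC.
Qed.

Lemma isomorphic_unitarily_equivalent (R : realType) (H H' : hilbertType R)
    (P : starRep 3 H) (P' : starRep 3 H') :
  irreducible_rep P -> irreducible_rep P' ->
  isomorphic (generated P) (generated P') -> unitarily_equivalent P P'.
Proof.
move=> irrP irrP' iso; have [A [bijA AS]] := iso.
have injA := bij_inj bijA.
have AP i : A @` range (P i) = range (P' i) by exact: AS.
have [trP|tP] := irreducible_trivial_or_tight irrP.
  have AC := trivial_intertwine trP AP.
  have [x x0] := @hilbert_nonzero R H.
  have [c c0 Ac] :=
    trivial_conformal x0 injA (trivial_irreducible_line irrP trP x0).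
  exact: conformal_unitarily_equivalent bijA AC c0 Ac.
have [trP'|tP'] := irreducible_trivial_or_tight irrP'.
  by have := trivial_tight_not_isomorphic tP trP' iso.
have AC : forall i x, A (P i x) = P' i (A x).
  apply: tight_intertwine => // i x Px; apply/rep_range.
  by rewrite -AP; exists x => //; apply/rep_range.
have [c c0 Ac] := tight_conformal injA tP tP' irrP AC.
exact: conformal_unitarily_equivalent bijA AC c0 Ac.
Qed.

(** * Transitive triples of subspaces of a vector space *)

Lemma ord3P (i : 'I_3) : [\/ i = 0, i = 1 | i = 2].
Proof.
case: i => [[|[|[|//]]] lt_i3]; [constructor 1|constructor 2|constructor 3];
exact: val_inj.
Qed.

Section Brick.
Variables (F : fieldType) (U : vectType F).
Implicit Types (x v : U) (W : {vspace U}).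

Lemma daddv_pi0 W1 W2 x : (W1 :&: W2 = 0)%VS -> x \in W2 -> daddv_pi W1 W2 x = 0.
Proof.
move=> W12 W2x; have W21 : (W2 :&: W1 = 0)%VS by rewrite capvC.
have := daddv_pi_add W21 (subvP (addvSl W2 W1) x W2x).
by rewrite daddv_pi_id // => /(canRL (addKr x)); rewrite addNr.
Qed.

Lemma exists_dual v : v != 0 -> exists psi : {linear U -> F^o}, psi v = 1.
Proof.
move=> v0; exists (coord [tuple v] 0).
by have := coord_free 0 0 (etrans (seq1_free v) v0).
Qed.

Variable V : 'I_3 -> {vspace U}.
(** Transitivity in purely linear terms: in representation theory, an object with only scalar
    endomorphisms is called a brick. *)
Hypothesis brickV : forall f : U -> U, linear f ->
  (forall i x, x \in V i -> f x \in V i) -> exists c, forall x, f x = c *: x.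

(** Take a nonzero operator with range the line of [v] and with [W] in its kernel. Each [V i]
    contains the range or lies in the kernel, so the operator is an endomorphism, hence a nonzero
    scalar. *)
Lemma brick_rank1 v W : v != 0 -> W != fullv ->
  (forall i, v \in V i \/ (V i <= W)%VS) -> forall x, exists a, x = a *: v.
Proof.
move=> v0 Wfull VW.
pose pi := daddv_pi W^C W.
have WC : (W^C :&: W = 0)%VS by rewrite capvC capv_compl.
pose y := vpick W^C%VS.
have y0 : y != 0.
  rewrite vpick0; apply: contraNneq Wfull => WC0.
  by rewrite -(addv_complf W) WC0 addv0.
have [psi psiy] := exists_dual y0.
have piy : pi y = y by rewrite /pi daddv_pi_id // memv_pick.
have [|i x Vx|c fc x] := @brickV (fun x => psi (pi x) *: v).
- by move=> a u w; rewrite !linearP /= scalerDl scalerA.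
- have [Vv|/subvP VW'] := VW i; first exact: memvZ.
  by rewrite /pi daddv_pi0 ?linear0 ?scale0r ?mem0v // VW'.
have c0 : c != 0.
  apply: contraNneq v0 => c0; have := fc y.
  by rewrite piy psiy scale1r c0 scale0r => ->.
exists (c^-1 * psi (pi x)).
by rewrite -scalerA fc scalerA mulVf ?scale1r.
Qed.

Hypothesis dimU : forall v, ~ (forall x, exists a, x = a *: v).

Lemma brick_no_rank1 v W : v != 0 -> W != fullv ->
  ~ (forall i, v \in V i \/ (V i <= W)%VS).
Proof. by move=> v0 W0 VW; apply: (dimU (brick_rank1 v0 W0 VW)). Qed.

Lemma brick_full_neq0 : (fullv : {vspace U}) != 0%VS.
Proof.
apply/eqP => U0; apply: (dimU (v := 0)) => x; exists 0.
by apply/eqP; rewrite scaler0 -memv0 -U0 memvf.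
Qed.

Lemma brick_neq0 : exists v : U, v != 0.
Proof. by exists (vpick fullv); rewrite vpick0 brick_full_neq0. Qed.

Lemma brick_zero_neq_full : (0%VS : {vspace U}) != fullv.
Proof. by rewrite eq_sym brick_full_neq0. Qed.

Section Complements.
Variables i j k : 'I_3.
Hypothesis ijk : forall l, [\/ l = i, l = j | l = k].

(** If [V i] were zero or full, the projection on [V j] along [V k] would be an endomorphism, hence
    a scalar. All three subspaces would then be zero or full, and [brick_no_rank1] would apply with
    [W = 0]. *)
Lemma brick_complement :
  (V j :&: V k = 0)%VS -> (V j + V k)%VS = fullv ->
  V i != 0%VS /\ V i != fullv.
Proof.
move=> jk0 jkT; suff Vi : ~~ ((V i == 0%VS) || (V i == fullv)).
  by apply/andP; rewrite -negb_or.
apply/negP => Vi; pose pi := daddv_pi (V j) (V k).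
have pi_j x : x \in V j -> pi x = x by move=> ?; rewrite /pi daddv_pi_id.
have pi_k x : x \in V k -> pi x = 0 by move=> ?; rewrite /pi daddv_pi0.
have [|l x Vx|c fc] := @brickV pi.
- by move=> a u w; rewrite linearP.
- case: (ijk l) Vx => -> Vx; last by rewrite pi_k ?mem0v.
    case/orP: Vi Vx => /eqP->; rewrite ?memvf // memv0 => /eqP->.
    by rewrite linear0 mem0v.
  by rewrite pi_j.
have {}Vi l : V l = 0%VS \/ V l = fullv.
  have [Vj0|Vj0] := eqVneq (V j) 0%VS.
    rewrite Vj0 add0v in jkT.
    by case: (ijk l) => ->; [case/orP: Vi => /eqP|..]; auto.
  have c1 : c = 1.
    have := fc (vpick (V j)); rewrite pi_j ?memv_pick // => /eqP.
    rewrite -subr_eq0 -{1}[vpick _]scale1r -scalerBl scaler_eq0 vpick0.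
    by rewrite (negPf Vj0) orbF subr_eq0 => /eqP.
  have Vk0 : V k = 0%VS.
    apply/eqP; rewrite -vpick0; have := fc (vpick (V k)).
    by rewrite pi_k ?memv_pick // c1 scale1r => <-.
  rewrite Vk0 addv0 in jkT.
  by case: (ijk l) => ->; [case/orP: Vi => /eqP|..]; auto.
have [v v0] := brick_neq0.
apply: (brick_no_rank1 v0 brick_zero_neq_full) => l.
by case: (Vi l) => ->; [right|left; rewrite memvf].
Qed.

(** A zero or full [V i] meets the condition of [brick_no_rank1] for all [v] and [W]. Taking [v] in
    [V j :&: V k], then [W = V j + V k], shows [V j] and [V k] supplementary, against
    [brick_complement]. *)
Lemma brick_proper : V i != 0%VS /\ V i != fullv.
Proof.
suff Vi : ~~ ((V i == 0%VS) || (V i == fullv)).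
  by apply/andP; rewrite -negb_or.
apply/negP => Vi.
have VW v W : v \in V i \/ (V i <= W)%VS.
  by case/orP: Vi => /eqP ->; [right; exact: sub0v|left; exact: memvf].
have jk0 : (V j :&: V k = 0)%VS.
  apply/eqP; rewrite -vpick0; apply/negPn/negP => v0.
  have /memv_capP[vj vk] := memv_pick (V j :&: V k).
  by apply: (brick_no_rank1 v0 brick_zero_neq_full) => l; case: (ijk l) => ->; auto.
have jkT : (V j + V k)%VS = fullv.
  apply/eqP/negPn/negP => WT; have [v v0] := brick_neq0.
  apply: (brick_no_rank1 v0 WT) => l.
  by case: (ijk l) => ->; auto; right; [exact: addvSl|exact: addvSr].
by have [] := brick_complement jk0 jkT; case/orP: Vi => /eqP ->; rewrite eqxx.
Qed.

(** Apply [brick_no_rank1] with [v] in [V j :&: V k] and [W = V i], then with [v] in [V i] and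
    [W = V j + V k]. *)
Lemma brick_supplementary : (V j :&: V k = 0)%VS /\ (V j + V k)%VS = fullv.
Proof.
have [Vi0 ViT] := brick_proper; split.
  apply/eqP; rewrite -vpick0; apply/negPn/negP => v0.
  have /memv_capP[vj vk] := memv_pick (V j :&: V k).
  by apply: (brick_no_rank1 v0 ViT) => l; case: (ijk l) => ->; auto.
apply/eqP/negPn/negP => WT; rewrite -vpick0 in Vi0.
apply: (brick_no_rank1 Vi0 WT) => l; case: (ijk l) => ->.
- by left; exact: memv_pick.
- by right; exact: addvSl.
- by right; exact: addvSr.
Qed.

End Complements.

(* Since [V 2] is the graph of an isomorphism [T : V 0 -> V 1], an endomorphism
   [S] of [V 0] extends to the endomorphism of the triple that is
   [T \o S \o T^-1] on [V 1]; below, [S = psi (_) *: u1]. *)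
Lemma brick_three_lines : exists u1 u2 : U,
  [/\ free [:: u1; u2], forall x, exists a b, x = a *: u1 + b *: u2,
      forall x, x \in V 0 <-> exists a, x = a *: u1,
      forall x, x \in V 1 <-> exists a, x = a *: u2 &
      forall x, x \in V 2 <-> exists a, x = a *: (u1 + u2)].
Proof.
have perm (i j k : 'I_3) : i != j -> j != k -> i != k ->
    forall l, [\/ l = i, l = j | l = k].
  by move: i j k; do 3![case=> [[|[|[|//]]] ?]] => // _ _ _ l; case: (ord3P l) => ->;
  do [by constructor 1; exact: val_inj | by constructor 2; exact: val_inj
     | by constructor 3; exact: val_inj].
have [V01 T01] := brick_supplementary (@perm 2 0 1 isT isT isT).
have [V02 T02] := brick_supplementary (@perm 1 0 2 isT isT isT).
have [V12 T12] := brick_supplementary (@perm 0 1 2 isT isT isT).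
have [] := brick_proper (@perm 2 0 1 isT isT isT).
rewrite -vpick0; set w := vpick (V 2) => w0 _.
have Vw : w \in V 2 := memv_pick _.
have V10 : (V 1 :&: V 0%R = 0)%VS by rewrite capvC.
pose p1 := daddv_pi (V 0) (V 1); pose p2 := daddv_pi (V 1) (V 0).
pose q := daddv_pi (V 0) (V 2).
have p12 x : p1 x + p2 x = x by rewrite daddv_pi_add // T01 memvf.
have Vp1 x : p1 x \in V 0 := memv_pi _ _ _.
have Vp2 x : p2 x \in V 1 := memv_pi _ _ _.
pose u1 := p1 w; pose u2 := p2 w.
have u12 : u1 + u2 = w := p12 w.
have disj (i j : 'I_3) x : (V i :&: V j = 0)%VS -> x \in V i -> x \in V j -> x = 0.
  by move=> Vij xi xj; apply/eqP; rewrite -memv0 -Vij memv_cap xi.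
have u1_0 : u1 != 0.
  apply: contraNneq w0 => u10; apply/eqP/(disj _ _ _ V12) => //.
  by rewrite -u12 u10 add0r Vp2.
have u2_0 : u2 != 0.
  apply: contraNneq w0 => u20; apply/eqP/(disj _ _ _ V02) => //.
  by rewrite -u12 u20 addr0 Vp1.
have [psi psi1] := exists_dual u1_0.
have p1_0 x : x \in V 0 -> p1 x = x by move=> ?; rewrite /p1 daddv_pi_id.
have p1_1 x : x \in V 1 -> p1 x = 0 by move=> ?; rewrite /p1 daddv_pi0.
have p2_0 x : x \in V 0 -> p2 x = 0 by move=> ?; rewrite /p2 daddv_pi0.
have p2_1 x : x \in V 1 -> p2 x = x by move=> ?; rewrite /p2 daddv_pi_id.
have q_0 x : x \in V 0 -> q x = x by move=> ?; rewrite /q daddv_pi_id.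
have q_2 x : x \in V 2 -> q x = 0 by move=> ?; rewrite /q daddv_pi0.
(* On [V 1] the map [- q] is [T^-1], since [q] kills the graph [V 2]; moreover [u2 = T u1]. *)
pose Rf x := psi (p1 x) *: u1 - psi (q (p2 x)) *: u2.
have R0 x : x \in V 0 -> Rf x = psi x *: u1.
  by move=> Vx; rewrite /Rf p1_0 // p2_0 // !linear0 scale0r subr0.
have R1 x : x \in V 1 -> Rf x = - psi (q x) *: u2.
  by move=> Vx; rewrite /Rf p1_1 // p2_1 // linear0 scale0r sub0r scaleNr.
have R2 x : x \in V 2 -> Rf x = psi (p1 x) *: (u1 + u2).
  move=> Vx; have qp2 : q (p2 x) = - p1 x.
    by rewrite -[p2 x](addKr (p1 x)) p12 linearD linearN /= [q x]q_2 // addr0 q_0.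
  by rewrite /Rf qp2 linearN scaleNr opprK scalerDr.
have [|i x|c Rc] := @brickV Rf.
- move=> a x y.
  have fP : psi (p1 (a *: x + y)) = a * psi (p1 x) + psi (p1 y).
    by rewrite !linearP.
  have gP : psi (q (p2 (a *: x + y))) = a * psi (q (p2 x)) + psi (q (p2 y)).
    by rewrite !linearP.
  by rewrite /Rf fP gP !scalerDl -!scalerA scalerBr opprD addrACA.
- case: (ord3P i) => -> Vx.
  + by rewrite R0 // memvZ // Vp1.
  + by rewrite R1 // memvZ // Vp2.
  + by rewrite R2 // memvZ // u12.
(* [Rf] fixes [u1], so the scalar is 1. Then [R0], [R1] and [R2] say that the three subspaces are
   lines. *)
have Rid x : Rf x = x.
  have := Rc u1; rewrite R0 ?Vp1 // psi1 => /eqP.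
  rewrite -subr_eq0 -scalerBl scaler_eq0 (negPf u1_0) orbF subr_eq0 => /eqP c1.
  by rewrite Rc -c1 scale1r.
exists u1, u2; split.
- rewrite free_cons seq1_free u2_0 andbT span_seq1; apply/vlineP => -[a u1E].
  move: u1_0; rewrite (disj _ _ u1 V01) ?eqxx ?Vp1 //.
  by rewrite u1E memvZ // Vp2.
- by move=> x; exists (psi (p1 x)), (- psi (q (p2 x))); rewrite scaleNr -[LHS]Rid.
- move=> x; split=> [Vx|[a ->]]; last by rewrite memvZ // Vp1.
  by exists (psi x); rewrite -R0 // Rid.
- move=> x; split=> [Vx|[a ->]]; last by rewrite memvZ // Vp2.
  by exists (- psi (q x)); rewrite -R1 // Rid.
- move=> x; split=> [Vx|[a ->]]; last by rewrite memvZ // u12.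
  by exists (psi (p1 x)); rewrite -R2 // Rid.
Qed.

End Brick.

(** * Finite dimensional Hilbert spaces *)

Section FiniteDimensional.
Variables (R : realType) (U : fdHilbertType R).

(** Inner products with a basis define an injective linear map to row vectors, onto by dimension.
    The preimages of the unit vectors form the dual basis. *)
Lemma fd_dual_basis : exists w : 'I_(\dim {:U}) -> U,
  forall x, x = \sum_i '[< x, w i >] *: (vbasis fullv)`_i.
Proof.
pose b i : U := (vbasis fullv)`_i.
pose T (x : U) : 'rV[R[i]]_(\dim {:U}) := \row_i '[< x, b i >].
have T_lin : linear T.
  by move=> a x y; apply/rowP => i; rewrite !mxE !innerE.
pose mT := GRing.isLinear.Build R[i] U _ _ T T_lin.
pose LT : {linear U -> 'rV[R[i]]_(\dim {:U})} := HB.pack T mT.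
pose f := linfun LT.
have fE x i : f x 0 i = '[< x, b i >] by rewrite lfunE /= mxE.
have kf : lker f == 0%VS.
  apply/lker0P => x y /rowP fxy; apply/eqP; rewrite -subr_eq0 -inner_eq0.
  rewrite [X in '[< _, X >]](coord_vbasis (memvf (x - y))) inner_sumr big1 // => i _.
  by rewrite innerZr innerDl innerNl -!fE fxy subrr mulr0.
have fT : limg f = fullv.
  apply/eqP; rewrite eqEdim subvf /= limg_dim_eq ?(eqP kf) ?capv0 //.
  by rewrite dimvf /dim /= mul1n.
pose w i := (f^-1)%VF (delta_mx 0 i); exists w => x.
have wE (i j : 'I_(\dim {:U})) : '[< w i, b j >] = (i == j)%:R.
  by rewrite -fE limg_lfunVK ?fT ?memvf // mxE eqxx eq_sym.
rewrite [LHS](coord_vbasis (memvf x)); apply: eq_bigr => i _; congr (_ *: _).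
rewrite [x in RHS](coord_vbasis (memvf x)) inner_suml (bigD1 i) //=.
rewrite innerZl innerC wE eqxx conjC1 mulr1 big1 ?addr0 // => j ji.
by rewrite innerZl innerC wE eq_sym (negPf ji) conjC0 mulr0.
Qed.

(** [fd_dual_basis] writes [f] as a finite sum of rank one operators. *)
Lemma fd_boundedOp (H : hilbertType R) (f : U -> H) : linear f ->
  exists A : boundedOp U H, A =1 f.
Proof.
move=> lin_f; have [w wE] := fd_dual_basis.
apply: boundedOpP => //.
pose mf := GRing.isLinear.Build R[i] U H _ f lin_f.
pose F : {linear U -> H} := HB.pack f mf.
have fE x : f x = \sum_i rank1 (w i) (f (vbasis fullv)`_i) x.
  rewrite [in LHS](wE x) -[f]/(F : U -> H) linear_sum.
  by apply: eq_bigr => i _; rewrite linearZZ.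
have [M bM] := bounded_map_sum (index_enum _)
  (fun i => rank1_bounded (w i) (f (vbasis fullv)`_i)).
by exists M => x; rewrite fE.
Qed.

(** Among the vector subspaces contained in [K], one of maximal dimension is all of [K]. *)
Lemma fd_clsubspace_vspace (K : clsubspace U) :
  exists V : {vspace U}, forall x, x \in V <-> (K : set U) x.
Proof.
have [K0 KL] := clsubspace_submod K.
pose p m := `[< exists V : {vspace U}, \dim V = m /\
  forall x, x \in V -> (K : set U) x >].
have p0 : exists m, p m.
  exists 0%N; apply/asboolP; exists 0%VS; split; first by rewrite dimv0.
  by move=> x; rewrite memv0 => /eqP ->; move: K0; rewrite inE.
have pU m : p m -> (m <= \dim {:U})%N.
  by move=> /asboolP[V [<- _]]; apply: dimvS; exact: subvf.
case: (ex_maxnP p0 pU) => m /asboolP[V [dimV VK]] maxm.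
exists V => x; split; first exact: VK.
move=> Kx; apply: contrapT => Vx.
have /maxm : p (\dim (V + <[x]>)%VS).
  apply/asboolP; exists (V + <[x]>)%VS; split=> // _
    /memv_addP[v Vv [_ /vlineP[a ->] ->]].
  rewrite addrC; have := KL a x v; rewrite !inE; apply=> //; exact: VK.
rewrite -dimV leqNgt => /negP; apply.
rewrite ltn_neqAle (dimv_leqif_eq (addvSl V <[x]>)).1 andbT.
rewrite (dimv_leqif_eq (addvSl V <[x]>)).2; apply/eqP => VE; apply: Vx.
by rewrite VE; apply: (subvP (addvSr V <[x]>)); exact: memv_line.
Qed.

Lemma fd_basis_change (u1 u2 e1 e2 : U) :
  free [:: u1; u2] -> (forall x, exists a b, x = a *: u1 + b *: u2) ->
  free [:: e1; e2] -> (forall x, exists a b, x = a *: e1 + b *: e2) ->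
  exists A : boundedOp U U, [/\ bijective A, A u1 = e1 & A u2 = e2].
Proof.
move=> fu su fe se.
have [f /(_ fu erefl)[fu1 fu2]] := linear_of_free [:: u1; u2] [:: e1; e2].
have [g /(_ fe erefl)[ge1 ge2]] := linear_of_free [:: e1; e2] [:: u1; u2].
have [A AE] := fd_boundedOp (linearP f).
exists A; split; rewrite ?AE //; exists g => x; rewrite AE.
  by have [a [b ->]] := su x; rewrite !linear_comb fu1 fu2 ge1 ge2.
by have [a [b ->]] := se x; rewrite !linear_comb ge1 ge2 fu1 fu2.
Qed.

(** Gram-Schmidt, starting from [u2]. *)
Lemma orthonormal_of_free (u1 u2 : U) :
  free [:: u1; u2] -> (forall x, exists a b, x = a *: u1 + b *: u2) ->
  exists x y : U, [/\ '[< x, x >] = 1, '[< y, y >] = 1, '[< x, y >] = 0 &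
    forall z, exists a b, z = a *: x + b *: y].
Proof.
have normalize (z : U) : z != 0 ->
    exists y (c : R[i]), [/\ c != 0, z = c *: y & '[< y, y >] = 1].
  move=> z0; have nz : `|z| != 0 by rewrite normr_eq0.
  exists (`|z|^-1 *: z), `|z|; split=> //.
    by rewrite scalerA mulfV ?scale1r.
  by rewrite !innerE inner_norm geC0_conj ?invr_ge0 //; field.
rewrite free_cons seq1_free span_seq1 => /andP[u12 u20] span_u.
have [y [d [d0 u2E yy]]] := normalize _ u20.
pose t := '[< u1, y >]; have zy : '[< u1 - t *: y, y >] = 0.
  by rewrite !innerE yy mulr1 subrr.
have : u1 - t *: y != 0.
  apply: contra u12; rewrite subr_eq0 => /eqP ->; apply/vlineP.
  by exists (t / d); rewrite u2E scalerA divfK.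
move=> /normalize[x [c [c0 zE xx]]].
exists x, y; split=> // [|v].
  by move: zy; rewrite zE innerZl => /eqP; rewrite mulf_eq0 (negPf c0) => /eqP.
have [a [b ->]] := span_u v; exists (a * c), (a * t + b * d).
rewrite u2E -[u1](subrK (t *: y)) zE scalerDr !scalerA -addrA.
by rewrite scalerDl.
Qed.

End FiniteDimensional.

(** * Tight frames of three vectors *)

Section Frame.
Variables (R : realType) (H : hilbertType R) (e : 'I_3 -> H).
Hypothesis e_unit : forall i, '[< e i, e i >] = 1.
Hypothesis e_tight : forall x, \sum_k rank1 (e k) (e k) x = (3 / 2) *: x.

Lemma frame_commute i x :
  \sum_k rank1 (e k) (e k) (rank1 (e i) (e i) x) =
  rank1 (e i) (e i) (\sum_k rank1 (e k) (e k) x).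
Proof. by rewrite !e_tight /rank1 innerZl scalerA. Qed.

Definition frame_rep : starRep 3 H :=
  @StarRep R 3 H (fun i => BoundedOp (rank1_bounded (e i) (e i)))
    (fun i => line_proj_unit (e_unit i)) frame_commute.

Lemma frame_range i : range (frame_rep i) = [set x | exists a : R[i], x = a *: e i].
Proof.
apply/seteqP; split=> x /=; first by move=> [y _ <-]; eexists; reflexivity.
by move=> [a ->]; exists (a *: e i) => //=; rewrite /rank1 innerZl e_unit mulr1.
Qed.

(** By tightness a nonzero vector of [M] has a nonzero inner product with some [e i], so [e i] is in
    [M]. As no two frame vectors are orthogonal, all of them are in [M], and by tightness they
    span. *)
Lemma frame_irreducible :
  (forall i j, '[< e i, e j >] != 0) -> irreducible_rep frame_rep.
Proof.
move=> e_neq0 M MP; have [M0 ML] := clsubspace_submod M.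
have MZ a x : (M : set H) x -> (M : set H) (a *: x).
  by move=> Mx; have := ML a x 0 (mem_set Mx) M0; rewrite addr0 inE.
have Me i x : (M : set H) x -> '[< x, e i >] != 0 -> (M : set H) (e i).
  move=> Mx xe; have /(MZ '[< x, e i >]^-1) : (M : set H) (frame_rep i x).
    by apply: (MP i); exists x.
  by rewrite /= /rank1 scalerA mulVf // scale1r.
have [[x Mx x0]|all0] := pselect (exists2 x, (M : set H) x & x != 0); last first.
  left; apply/seteqP; split=> x /= => [Mx|->]; last by move: M0; rewrite inE.
  by apply: contrapT => /eqP x0; apply: all0; exists x.
right; apply/seteqP; split=> // y _.
have [i xi] : exists i, '[< x, e i >] != 0.
  apply: contrapT => xe; have := e_tight x.
  rewrite big1 => [/esym/eqP|k _].
    by rewrite scaler_eq0 (negPf x0) orbF mulf_eq0 invr_eq0 !pnatr_eq0.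
  rewrite /rank1; have [->|xk] := eqVneq '[< x, e k >] 0; first by rewrite scale0r.
  by exfalso; apply: xe; exists k.
have Mek k : (M : set H) (e k) by apply: (Me k (e i)) => //; exact: (Me i x).
have : (M : set H) (\sum_k rank1 (e k) (e k) y).
  apply: big_ind => [|u v Mu Mv|k _]; first by move: M0; rewrite inE.
    by have := ML 1 u v (mem_set Mu) (mem_set Mv); rewrite scale1r inE.
  exact: MZ.
rewrite e_tight => /(MZ (3 / 2)^-1); rewrite scalerA mulVf ?scale1r //.
Qed.

End Frame.

Lemma big_ord3 (V : nmodType) (F : 'I_3 -> V) : \sum_i F i = F 0 + F 1 + F 2.
Proof.
rewrite !big_ord_recr big_ord0 /= add0r.
by congr (F _ + F _ + F _); exact: val_inj.
Qed.

(* The lines of the three vectors are at angles of 120 degrees, so that their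
   projections have sum [3 / 2]. *)
Lemma mercedes_frame (R : realType) (H : hilbertType R) (x y : H) :
  '[< x, x >] = 1 -> '[< y, y >] = 1 -> '[< x, y >] = 0 ->
  (forall z, exists a b, z = a *: x + b *: y) ->
  exists e : 'I_3 -> H, [/\ forall i, '[< e i, e i >] = 1,
    forall z, \sum_k rank1 (e k) (e k) z = (3 / 2) *: z,
    forall i j, '[< e i, e j >] != 0, e 0 + e 1 = - e 2 & e 0 = x /\
    exists2 s : R[i], s != 0 & e 1 = - 2^-1 *: x + s *: y].
Proof.
(* [- 2^-1] and [s] are the cosine and sine of 120 degrees. *)
move=> xx yy xy span_xy; pose s : R[i] := sqrtC 3 / 2.
have yx : '[< y, x >] = 0 by rewrite innerC xy conjC0.
have ss : s * s = 3 / 4.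
  have s3 : sqrtC 3 * sqrtC 3 = 3 :> R[i] by rewrite -expr2 sqrtCK.
  by rewrite /s mulrACA s3; field.
have s_conj : Num.conj s = s.
  by rewrite geC0_conj // divr_ge0 ?sqrtC_ge0 ?ler0n.
have s0 : s != 0 by rewrite mulf_neq0 ?invr_eq0 ?sqrtC_eq0 ?pnatr_eq0.
have h_conj : Num.conj (- 2^-1) = - 2^-1 :> R[i].
  by rewrite rmorphN fmorphV rmorph_nat.
have sN_conj : Num.conj (- s) = - s by rewrite rmorphN; congr (- _).
pose e (i : 'I_3) : H :=
  nth 0 [:: x; - 2^-1 *: x + s *: y; - 2^-1 *: x - s *: y] i.
have e0 : e 0 = x by [].
have e1 : e 1 = - 2^-1 *: x + s *: y by [].
have e2 : e 2 = - 2^-1 *: x - s *: y by [].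
have ip (a b c d : R[i]) : Num.conj c = c -> Num.conj d = d ->
    '[< a *: x + b *: y, c *: x + d *: y >] = a * c + b * d.
  by move=> cc dd; rewrite !innerE xx yy xy yx cc dd; ring.
have eE i : exists a b : R[i], [/\ e i = a *: x + b *: y, Num.conj a = a,
   Num.conj b = b & [\/ a = 1 /\ b = 0, a = - 2^-1 /\ b = s | a = - 2^-1 /\ b = - s]].
  case: (ord3P i) => ->.
  - exists 1, 0; rewrite e0 scale1r scale0r addr0 conjC1 conjC0.
    by split=> //; constructor 1.
  - by exists (- 2^-1), s; rewrite e1; split=> //; constructor 2.
  - exists (- 2^-1), (- s); rewrite e2.
    split=> [|||]; rewrite ?scaleNr //.
    by constructor 3.
exists e; split.
- move=> i; have [a [b [-> ac bc ab]]] := eE i; rewrite ip //.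
  by case: ab => -[-> ->]; rewrite ?mulrNN ?ss; field.
- move=> z; have [a [b ->]] := span_xy z.
  rewrite big_ord3 /rank1.
  rewrite e0 e1 e2 !innerE xx yy xy yx h_conj s_conj.
  have sbb : s * (b * s) = 3 / 4 * b by rewrite mulrCA ss mulrC.
  apply: inner_inj => w; rewrite !innerE.
  apply: (eq_of_subr (congr1 (fun t => 2 * '[< y, w >] * t) sbb)).
  by field.
(* The inner products are 1 on the diagonal and -1/2 elsewhere. *)
- move=> i j; have [a [b [-> ac bc ab]]] := eE i.
  have [c [d [-> cc dc cd]]] := eE j; rewrite ip //.
  have n2 : (2 : R[i]) != 0 by rewrite pnatr_eq0.
  have q : - 2^-1 * - 2^-1 + - s * s = - 2^-1 by rewrite [- s * s]mulNr ss; field.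
  have q' : - 2^-1 * - 2^-1 + s * - s = - 2^-1 by rewrite [s * - s]mulrN ss; field.
  have p : - 2^-1 * - 2^-1 + s * s = 1 by rewrite ss; field.
  by case: ab => -[-> ->]; case: cd => -[-> ->];
    rewrite ?mulr0 ?mul0r ?addr0 ?mulr1 ?mul1r ?[- s * - s]mulrNN ?q ?q' ?p;
    rewrite ?oppr_eq0 ?invr_eq0 ?oner_eq0.
- by rewrite e0 e1 e2; apply: inner_inj => w; rewrite !innerE; field.
- by split=> //; exists s.
Qed.

(** * Representations generating the transitive systems *)

Section TrivialRepresentation.
Variables (R : realType) (H : hilbertType R) (b : 'I_3 -> bool).

Lemma trivial_op_exists i : exists A : boundedOp H H, A =1 fun x => (b i)%:R *: x.
Proof.
apply: boundedOpP; last by apply: bounded_mapZ; exists 1 => x; rewrite mul1r.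
by move=> a x y; rewrite scalerDr !scalerA mulrC.
Qed.

Lemma trivial_rep_exists :
  exists P : starRep 3 H, forall i x, P i x = (b i)%:R *: x.
Proof.
have [P PE] := choice trivial_op_exists.
have P_orth i : orthogonal_projection (P i).
  split=> [x|x y]; rewrite !PE; first by case: (b i); rewrite ?scale1r // !scale0r.
  by case: (b i); rewrite ?scale1r // !scale0r inner0l inner0r.
have P_com i x : \sum_k P k (P i x) = P i (\sum_k P k x).
  by rewrite linear_sum; apply: eq_bigr => k _; rewrite !PE !scalerA mulrC.
by exists (StarRep P_orth P_com).
Qed.

End TrivialRepresentation.

Section Classification.
Variables (R : realType) (U : fdHilbertType R) (K : system 3 U).
Hypothesis trK : transitive_system K.

Lemma transitive_scalar (f : U -> U) : linear f ->
  (forall i x, (K i : set U) x -> (K i : set U) (f x)) ->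
  exists c : R[i], forall x, f x = c *: x.
Proof.
move=> lin_f fK; have [A AE] := fd_boundedOp lin_f.
have : endomorphisms K A by move=> i _ [x Kx <-]; rewrite AE; exact: fK.
by rewrite trK => -[c Ac]; exists c => x; rewrite -AE.
Qed.

(** In a line every subspace is zero or full, so [K] is generated by projections equal to 0 or 1,
    and the identity is the isomorphism. *)
Lemma line_system_representation (v : U) :
  (forall x, exists a : R[i], x = a *: v) ->
  exists (H : hilbertType R) (P : starRep 3 H),
    irreducible_rep P /\ isomorphic K (generated P).
Proof.
move=> span_v.
have full (M : clsubspace U) x : (M : set U) x -> x != 0 -> (M : set U) = setT.
  move=> Mx x0; apply/seteqP; split=> // y _.
  have [M0 ML] := clsubspace_submod M.
  have [a xE] := span_v x; have [c ->] := span_v y.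
  have a0 : a != 0 by apply: contraNneq x0 => a0; rewrite xE a0 scale0r.
  have -> : c *: v = (c / a) *: x + 0 by rewrite addr0 xE scalerA divfK.
  by have := ML (c / a) x 0 (mem_set Mx) M0; rewrite inE.
have zero_or_full (M : clsubspace U) : (M : set U) = [set 0] \/ (M : set U) = setT.
  have [[x Mx x0]|all0] := pselect (exists2 x, (M : set U) x & x != 0).
    by right; exact: full x0.
  left; apply/seteqP; split=> x /= => [Mx|->].
    by apply: contrapT => /eqP x0; apply: all0; exists x.
  by have := (clsubspace_submod M).1; rewrite inE.
have [P PE] := @trivial_rep_exists R U (fun i => `[< (K i : set U) = setT >]).
exists U, P; split; first by move=> M _; exact: zero_or_full.
have [A AE] : exists A : boundedOp U U, A =1 id by exact: fd_boundedOp.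
exists A; split; first by exists id => x; rewrite AE.
move=> i; have -> : A @` K i = K i.
  apply/seteqP; split=> [_ [x Kx <-]|x Kx]; first by rewrite AE.
  by exists x; rewrite ?AE.
have genE : (generated P i : set U) = range (P i) by [].
rewrite genE; apply/seteqP; split=> x.
  move=> Kx; exists x => //; rewrite PE.
  case: (asboolP (_ = setT)) => [_|KT]; first by rewrite scale1r.
  case: (zero_or_full (K i)) => // K0; move: Kx; rewrite K0 => ->.
  by rewrite scaler0.
move=> [y _ <-]; rewrite PE; case: (asboolP (_ = setT)) => [->//|_].
by rewrite scale0r; have := (clsubspace_submod (K i)).1; rewrite inE.
Qed.

(** The frame is built in [U] itself. The map sending [u1], [u2] to [e 0], [e 1] sends [u1 + u2] to
    [- e 2], hence matches all three lines. *)
Lemma plane_system_representation :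
  ~ (exists v : U, forall x, exists a : R[i], x = a *: v) ->
  exists (H : hilbertType R) (P : starRep 3 H),
    irreducible_rep P /\ isomorphic K (generated P).
Proof.
move=> not_line; have [V VK] := choice (fun i => fd_clsubspace_vspace (K i)).
have [|v vspan|u1 [u2 [fu su V0 V1 V2]]] := @brick_three_lines _ U V.
- move=> f lin_f fV; apply: transitive_scalar => // i x.
  by rewrite -!VK; exact: fV.
- by apply: not_line; exists v.
have [x [y [xx yy xy sxy]]] := orthonormal_of_free fu su.
have [e [ee et en e012 [e0 [s s0 e1]]]] := mercedes_frame xx yy xy sxy.
have x0 : x != 0 by rewrite -inner_eq0 xx oner_eq0.
have y0 : y != 0 by rewrite -inner_eq0 yy oner_eq0.
have yE : y = s^-1 *: e 1 + (s^-1 / 2) *: e 0.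
  rewrite e1 e0 scalerDr !scalerA mulVf // scale1r addrAC -scalerDl.
  by rewrite mulrN addNr scale0r add0r.
have fe : free [:: e 0; e 1].
  rewrite free_cons seq1_free span_seq1; apply/andP; split.
    (* Pair with [y], which is orthogonal to [e 0] but not to [e 1]. *)
    apply/vlineP => -[a e0E].
    have : '[< e 0, y >] = a * '[< e 1, y >] by rewrite e0E innerZl.
    rewrite e0 e1 innerDl !innerZl xy yy mulr0 add0r mulr1 => /esym/eqP.
    rewrite mulf_eq0 (negPf s0) orbF => /eqP a0.
    by move: e0E x0; rewrite -e0 a0 scale0r => ->; rewrite eqxx.
  by rewrite -inner_eq0 ee oner_eq0.
have se z : exists a b, z = a *: e 0 + b *: e 1.
  have [a [b ->]] := sxy z; exists (a + b * (s^-1 / 2)), (b / s).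
  by rewrite yE -e0 scalerDr !scalerA scalerDl -addrA [_ + (b / s) *: _]addrC.
have [A [bijA Au1 Au2]] := fd_basis_change fu su fe se.
exists U, (frame_rep ee et); split; first exact: frame_irreducible.
exists A; split=> // i.
have image_line (u z : U) (c : R[i]) : c != 0 -> A u = c *: z ->
    (forall w, w \in V i <-> exists a, w = a *: u) ->
    A @` K i = [set w | exists a : R[i], w = a *: z].
  move=> c0 Au Vi; apply/seteqP; split=> [_ [w /VK/Vi[a ->] <-]|_ /= [a ->]].
    by exists (a * c); rewrite linearZZ Au scalerA.
  exists ((a / c) *: u); first by apply/VK/Vi; eexists.
  by rewrite linearZZ Au scalerA divfK.
have genE : (generated (frame_rep ee et) i : set U) = range (frame_rep ee et i) by [].
rewrite genE frame_range; case: (ord3P i) => iE; rewrite -> iE in image_line |- *.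
- by apply: (image_line u1 _ 1); rewrite ?oner_eq0 ?scale1r.
- by apply: (image_line u2 _ 1); rewrite ?oner_eq0 ?scale1r.
- apply: (image_line (u1 + u2) _ (- 1)) => //; rewrite ?oppr_eq0 ?oner_eq0 //.
  by rewrite linearD Au1 Au2 e012 scaleN1r.
Qed.

Lemma transitive_representation :
  exists (H : hilbertType R) (P : starRep 3 H),
    irreducible_rep P /\ isomorphic K (generated P).
Proof.
have [[v span_v]|] :=
  pselect (exists v : U, forall x, exists a : R[i], x = a *: v).
  exact: line_system_representation span_v.
exact: plane_system_representation.
Qed.

End Classification.

Theorem proposition7 (R : realType) :
  [/\ forall (H : hilbertType R) (P : starRep 3 H),
        irreducible_rep P -> transitive_system (generated P),
      forall (H H' : hilbertType R) (P : starRep 3 H) (P' : starRep 3 H'),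
        irreducible_rep P -> irreducible_rep P' -> ~ unitarily_equivalent P P' ->
        ~ isomorphic (generated P) (generated P') &
      forall (U : fdHilbertType R) (K : system 3 U), transitive_system K ->
        exists (H : hilbertType R) (P : starRep 3 H),
          irreducible_rep P /\ isomorphic K (generated P)].
Proof.
split=> [H P|H H' P P' irrP irrP' neqP iso|U K].
- exact: irreducible_transitive.
- exact/neqP/isomorphic_unitarily_equivalent.
- exact: transitive_representation.
Qed.
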